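(* Let $1\le W\le N/3$, $\zeta>1$, $p\ge1$, $\bar\theta>0$, and $L_N$ with $4\bar\theta\le L_N\le(2N+1)\bar\theta$. For any online algorithm $\mathcal A$ there exists an LQ tracking problem of the form $\frac12\sum_{t=0}^{N-1}\big[(x_t-\theta_t)^\top Q(x_t-\theta_t)+u_t^\top Ru_t\big]+\frac12x_N^\top P^ex_N$ (with $Q>0,R>0$, $P^e$ the positive definite solution of the DARE $P^e=Q+A^\top(P^e-P^eB(B^\top P^eB+R)^{-1}B^\top P^e)A$, $x_0=0$, $\|\theta_t\|\le\bar\theta$) such that (i) $(A,B)$ is in canonical form with controllability index $p$; (ii) $\sum_{t=0}^N\|\theta_t-\theta_{t-1}\|\le L_N$ (with $\theta_{-1}=0$, $\theta_N=0$); (iii) the associated $C(\mathbf z)$ has condition number $\zeta$; and $$\mathrm{Regret}(\mathcal A)\ge c\Big(\frac{\sqrt\zeta-1}{\sqrt\zeta+1}\Big)^{2K}L_N\ \ge c\Big(\frac{\sqrt\zeta-1}{\sqrt\zeta+1}\Big)^{2K}\sum_{t=0}^N\|\theta_t-\theta_{t-1}\|,$$ where $K=\lfloor(W-1)/p\rfloor$ and $c>0$ is a constant independent of $N$, $W$ and $L_N$.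
   Context: Canonical form: indices $0=k_0<k_1<\dots<k_m=n$, $\mathcal I=\{k_1,\dots,k_m\}$; rows $i\notin\mathcal I$ of $A$ equal $e_{i+1}^\top$, rows in $\mathcal I$ arbitrary; $j$-th column of $B$ is $e_{k_j}$; controllability index $p=\max_i(k_i-k_{i-1})$. An online algorithm with lookahead $W$ is a map $u_t=\mathcal A(x_t,\dots,x_0,\{f_s,g_s\}_{s=0}^{t+W-1})$, where here $f_s(x)=\frac12(x-\theta_s)^\top Q(x-\theta_s)$, $g_s(u)=\frac12u^\top Ru$; $\mathrm{Regret}(\mathcal A)=J(\mathcal A)-J^*$ with $J^*$ the offline optimal cost. $C(\mathbf z)$ is the cost in the variables $z_t=x_t^{\mathcal I}$: $C(\mathbf z)=J(\mathbf x(\mathbf z),\mathbf u(\mathbf z))$ with $x_t(\mathbf z)=(z^1_{t-p_1+1},\dots,z^1_t,\dots,z^m_{t-p_m+1},\dots,z^m_t)^\top$, $u_t(\mathbf z)=z_{t+1}-A(\mathcal I,:)x_t(\mathbf z)$, $z_t=0$ for $t\le0$; it is a quadratic, and its condition number is the ratio of the largest to smallest eigenvalue of its Hessian. *)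

(* Defs.v *)
From HB Require Import structures.
From mathcomp Require Import all_boot all_order all_algebra.
Set Implicit Arguments. Unset Strict Implicit. Unset Printing Implicit Defensive.
Import Order.TTheory GRing.Theory Num.Theory.
Local Open Scope ring_scope.

Section LQ.
Variable R : rcfType.

Definition qform n (M : 'M[R]_n) (v : 'cV[R]_n) : R := (v^T *m M *m v) 0 0.

Definition vnorm n (v : 'cV[R]_n) : R := Num.sqrt ((v^T *m v) 0 0).

Definition posdef n (M : 'M[R]_n) : Prop :=
  M^T = M /\ forall v : 'cV[R]_n, v != 0 -> 0 < qform M v.

Definition dare n m (A : 'M[R]_n) (B : 'M[R]_(n, m)) (Q : 'M[R]_n)
    (Rc : 'M[R]_m) (P : 'M[R]_n) : Prop :=
  P = Q + A^T *m (P - P *m B *m invmx (B^T *m P *m B + Rc) *m B^T *m P) *m A.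

(* Canonical form (0-based rows/columns; paper's row i is row i-1 here).
   k : nat -> nat lists 0 = k 0 < k 1 < ... < k m = n. *)
Definition canonical_form n m (A : 'M[R]_n) (B : 'M[R]_(n, m)) (k : nat -> nat)
    : Prop :=
  [/\ k 0%N = 0%N, k m = n,
      (forall i, (i < m)%N -> (k i < k i.+1)%N),
      (forall r : 'I_n, (forall j, (1 <= j <= m)%N -> r.+1 != k j) ->
          forall c : 'I_n, A r c = ((c : nat) == r.+1)%:R)
    & (forall (r : 'I_n) (j : 'I_m), B r j = (r.+1 == k j.+1)%:R)].

Definition ctrb_index m (k : nat -> nat) : nat := (\max_(i < m) (k i.+1 - k i))%N.

Definition lqcost n m (N : nat) (Q : 'M[R]_n) (Rc : 'M[R]_m) (Pe : 'M[R]_n)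
    (theta : nat -> 'cV[R]_n) (x : nat -> 'cV[R]_n) (u : nat -> 'cV[R]_m) : R :=
  2^-1 * (\sum_(t < N) (qform Q (x t - theta t) + qform Rc (u t)))
  + 2^-1 * qform Pe (x N).

Fixpoint traj n m (A : 'M[R]_n) (B : 'M[R]_(n, m)) (u : nat -> 'cV[R]_m)
    (t : nat) : 'cV[R]_n :=
  match t with
  | 0 => 0
  | t'.+1 => A *m traj A B u t' + B *m u t'
  end.

(* An online algorithm (knowing the system and the horizon):
   u_t = alg t (x_0..x_t) (f_s)_s (g_s)_s, with causality / lookahead W. *)
Definition online_alg : Type :=
  forall (n m N : nat) (A : 'M[R]_n) (B : 'M[R]_(n, m)),
    nat -> (nat -> 'cV[R]_n) -> (nat -> 'cV[R]_n -> R) -> (nat -> 'cV[R]_m -> R)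
    -> 'cV[R]_m.

Definition lookahead (W : nat) (alg : online_alg) : Prop :=
  forall n m N A B t (h h' : nat -> 'cV[R]_n) (f f' : nat -> 'cV[R]_n -> R)
    (g g' : nat -> 'cV[R]_m -> R),
    (forall s, (s <= t)%N -> h s = h' s) ->
    (forall s, (s < t + W)%N -> forall v, f s v = f' s v) ->
    (forall s, (s < t + W)%N -> forall v, g s v = g' s v) ->
    @alg n m N A B t h f g = @alg n m N A B t h' f' g'.

Fixpoint cl_hist (alg : online_alg) (n m N : nat) (A : 'M[R]_n) (B : 'M[R]_(n, m))
    (f : nat -> 'cV[R]_n -> R) (g : nat -> 'cV[R]_m -> R) (t : nat)
    : nat -> 'cV[R]_n :=
  match t with
  | 0 => fun _ => 0
  | t'.+1 =>
      let h := @cl_hist alg n m N A B f g t' in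
      fun s => if (s <= t')%N then h s
               else A *m h t' + B *m @alg n m N A B t' h f g
  end.

Definition cl_state (alg : online_alg) (n m N : nat) (A : 'M[R]_n) (B : 'M[R]_(n, m)) f g (t : nat) : 'cV[R]_n :=
  @cl_hist alg n m N A B f g t t.
Definition cl_input (alg : online_alg) (n m N : nat) (A : 'M[R]_n) (B : 'M[R]_(n, m)) f g (t : nat) : 'cV[R]_m :=
  @alg n m N A B t (@cl_hist alg n m N A B f g t) f g.

Definition fcost n (Q : 'M[R]_n) (theta : nat -> 'cV[R]_n) (s : nat) (v : 'cV[R]_n) : R :=
  2^-1 * qform Q (v - theta s).
Definition gcost m (Rc : 'M[R]_m) (s : nat) (v : 'cV[R]_m) : R := 2^-1 * qform Rc v.

Definition alg_cost (alg : online_alg) (n m N : nat) (A : 'M[R]_n) (B : 'M[R]_(n, m)) (Q : 'M[R]_n) (Rc : 'M[R]_m) (Pe : 'M[R]_n) (theta : nat -> 'cV[R]_n) : R :=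
  @lqcost n m N Q Rc Pe theta
    (@cl_state alg n m N A B (fcost Q theta) (gcost Rc))
    (@cl_input alg n m N A B (fcost Q theta) (gcost Rc)).

Definition pathlen n (N : nat) (theta : nat -> 'cV[R]_n) : R :=
  vnorm (theta 0%N) + \sum_(1 <= t < N.+1) vnorm (theta t - theta t.-1).

(* entry number i of the stacked vector Z = (z_1; ...; z_N), 0 beyond *)
Definition Zentry d (Z : 'cV[R]_d) (i : nat) : R := \sum_(l < d | (l : nat) == i) Z l 0.
(* z^j_s (j 0-based), z_s = 0 for s <= 0 *)
Definition zval m d (Z : 'cV[R]_d) (s j : nat) : R :=
  if (0 < s)%N then Zentry Z ((s.-1) * m + j)%N else 0.

(* x_t(z): coordinate r (0-based) in block j+1 (k_j < r+1 <= k_{j+1}) is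
   z^{j+1}_{t-(k_{j+1}-(r+1))} *)
Definition xz n m d (k : nat -> nat) (Z : 'cV[R]_d) (t : nat) : 'cV[R]_n :=
  \col_(r < n) \sum_(j < m)
      (if (k j < r.+1 <= k j.+1)%N then zval m Z (t + r.+1 - k j.+1)%N j else 0).

(* u_t(z) = z_{t+1} - A(I,:) x_t(z) *)
Definition uz n m d (A : 'M[R]_n) (k : nat -> nat) (Z : 'cV[R]_d) (t : nat) : 'cV[R]_m :=
  \col_(j < m) (zval m Z t.+1 j -
     \sum_(r < n | r.+1 == k j.+1) \sum_(c < n) A r c * (@xz n m d k Z t) c 0).

Definition Cz n m N (A : 'M[R]_n) (k : nat -> nat) Q Rc Pe theta
    (Z : 'cV[R]_(N * m)) : R :=
  @lqcost n m N Q Rc Pe theta (@xz n m (N * m) k Z) (@uz n m (N * m) A k Z).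

Definition cond_number d (H : 'M[R]_d) (zeta : R) : Prop :=
  exists lmin lmax : R,
    [/\ eigenvalue H lmin, eigenvalue H lmax,
        (forall l, eigenvalue H l -> lmin <= l <= lmax),
        0 < lmin & lmax / lmin = zeta].

Definition quad_cond d (C : 'cV[R]_d -> R) (zeta : R) : Prop :=
  exists (H : 'M[R]_d) (b : 'cV[R]_d) (c0 : R),
    [/\ H^T = H,
        (forall Z, C Z = 2^-1 * (Z^T *m H *m Z) 0 0 + (b^T *m Z) 0 0 + c0)
      & cond_number H zeta].

End LQ.

(* Main.v *)
(** The system has one chain of length [p] (a cyclic shift with input) and two
    one-step channels. Put [r = (sqrt zeta - 1) / (sqrt zeta + 1)]. The costs are
    chosen so that completing the squares turns the tracking cost of the chain
    into the sum of the [(z_s - r z_(s-p) - w_s)^2 / 2], where [w_s] is a discounted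
    sum of future targets; the terminal cost given by the DARE makes this exact up
    to the horizon. The chain's Hessian therefore has spectrum in
    [[(1 - r)^2, (1 + r)^2]]; the two extra channels have the scalar Hessians
    [(1 - r)^2] and [(1 + r)^2], so the condition number is exactly
    [((1 + r) / (1 - r))^2 = zeta] whatever the horizon.

    The regret is half the weighted sum of squares of the deviations from the
    feedforward [w]. The target at time [t + W], invisible at time [t], enters the
    feedforward of time [t] with coefficient [r^K] times a constant, if it points in
    the coordinate selected by the residue of [W - 1] modulo [p]. Hence flipping its
    sign costs the algorithm of order [r^(2K)] on one of the two choices; averaging
    over all sign patterns of [M] consecutive targets, with [M] of order [L_N],
    gives a bad pattern. *)
Require Import Defs.
From HB Require Import structures.
From mathcomp Require Import all_boot all_order all_algebra.
From mathcomp Require Import zify ring lra.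
Set Implicit Arguments. Unset Strict Implicit. Unset Printing Implicit Defensive.
Import Order.TTheory GRing.Theory Num.Theory.
Local Open Scope ring_scope.

(** * Dot products and diagonal quadratic forms *)

Section Dot.
Variable R : rcfType.

Definition dot n (x y : 'cV[R]_n) : R := (x^T *m y) 0 0.

Lemma dotC n (x y : 'cV[R]_n) : dot x y = dot y x.
Proof. by rewrite /dot -[y in LHS]trmxK -trmx_mul mxE. Qed.

Lemma dotDr n (x y z : 'cV[R]_n) : dot x (y + z) = dot x y + dot x z.
Proof. by rewrite /dot mulmxDr mxE. Qed.

Lemma dotDl n (x y z : 'cV[R]_n) : dot (y + z) x = dot y x + dot z x.
Proof. by rewrite dotC dotDr !(dotC x). Qed.

Lemma dotNr n (x y : 'cV[R]_n) : dot x (- y) = - dot x y.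
Proof. by rewrite /dot mulmxN mxE. Qed.

Lemma dotNl n (x y : 'cV[R]_n) : dot (- y) x = - dot y x.
Proof. by rewrite dotC dotNr dotC. Qed.

Lemma dot0r n (x : 'cV[R]_n) : dot x 0 = 0.
Proof. by rewrite /dot mulmx0 mxE. Qed.

Lemma dot_mulmx n m (M : 'M[R]_(n, m)) x y : dot (M *m x) y = dot x (M^T *m y).
Proof. by rewrite /dot trmx_mul mulmxA. Qed.

Lemma dot_sumr n I (s : seq I) (x : 'cV[R]_n) (F : I -> 'cV[R]_n) :
  dot x (\sum_(i <- s) F i) = \sum_(i <- s) dot x (F i).
Proof. by rewrite /dot mulmx_sumr summxE. Qed.

Lemma qformE n (M : 'M[R]_n) x : qform M x = dot x (M *m x).
Proof. by rewrite /qform /dot mulmxA. Qed.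

Lemma qform_diag n (d : 'rV[R]_n) x :
  qform (diag_mx d) x = \sum_i d 0 i * x i 0 ^+ 2.
Proof.
rewrite qformE /dot mxE; apply: eq_bigr => i _.
by rewrite mul_diag_mx !mxE; ring.
Qed.

Lemma qform_diag_ge0 n (d : 'rV[R]_n) x :
  (forall i, 0 < d 0 i) -> 0 <= qform (diag_mx d) x.
Proof.
move=> d_gt0; rewrite qform_diag sumr_ge0 // => i _.
by rewrite mulr_ge0 ?sqr_ge0 ?ltW.
Qed.

Lemma posdef_diag n (d : 'rV[R]_n) :
  (forall i, 0 < d 0 i) -> posdef (diag_mx d).
Proof.
move=> d_gt0; split=> [|v v0]; first exact: tr_diag_mx.
have [i vi0] : exists i, v i 0 != 0.
  apply/existsP; apply: contraNT v0; rewrite negb_exists => /forallP v0.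
  by apply/eqP/colP => i; rewrite mxE; apply/eqP; have := v0 i; rewrite negbK.
rewrite qform_diag (bigD1 i) //= ltr_pwDl //.
  by rewrite mulr_gt0 // exprn_even_gt0.
by rewrite sumr_ge0 // => j _; rewrite mulr_ge0 ?sqr_ge0 ?ltW.
Qed.

Lemma unitmx_diag n (d : 'rV[R]_n) :
  (forall i, 0 < d 0 i) -> diag_mx d \in unitmx.
Proof.
move=> d_gt0; rewrite unitmxE det_diag unitfE.
by apply/prodf_neq0 => i _; rewrite gt_eqF.
Qed.

End Dot.

(** * Completion of squares along a DARE solution *)

Section CompletionOfSquares.
Variable R : rcfType.
Variables (n m : nat) (A : 'M[R]_n) (B : 'M[R]_(n, m)).
Variables (Q P : 'M[R]_n) (Rc S : 'M[R]_m) (K : 'M[R]_(m, n)).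
Hypotheses (trQ : Q^T = Q) (trP : P^T = P) (trS : S^T = S).
Hypothesis defS : S = B^T *m P *m B + Rc.
Hypothesis defK : S *m K = B^T *m P *m A.
Hypothesis defP : P = Q + A^T *m P *m (A - B *m K).

(** Lets the Riccati equation be checked through the two inverse-free identities [defK] and [defP]:
    invertibility of [S] forces [K = S^-1 B^T P A]. *)
Lemma dare_of_gain : S \in unitmx -> dare A B Q Rc P.
Proof.
move=> Su; rewrite /dare -defS {1}defP; congr (_ + _).
have -> : K = invmx S *m (B^T *m P *m A) by rewrite -defK mulKmx.
by rewrite mulmxBr mulmxBr mulmxBl !mulmxA.
Qed.

Definition Acl := A - B *m K.

(** One dynamic programming step for a cost-to-go [qform P x - 2 <be, x>]. The Riccati equation
    reproduces [P], the linear coefficient moves back to [Q th + Acl^T be], and what depends on [u]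
    is a square with minimizer [v - K x]. *)
Lemma stage_cost_square (x th be : 'cV[R]_n) (u v : 'cV[R]_m) :
  S *m v = B^T *m be ->
  qform Q (x - th) + qform Rc u + qform P (A *m x + B *m u)
    - 2 * dot be (A *m x + B *m u)
  = qform P x - 2 * dot (Q *m th + Acl^T *m be) x
    + qform S (u + K *m x - v) + (qform Q th - qform S v).
Proof.
move=> defv.
have eSu : qform S u = qform P (B *m u) + qform Rc u.
  by rewrite !qformE defS mulmxDl dotDr -!mulmxA dot_mulmx.
have eSK w : dot w (S *m (K *m x)) = dot (B *m w) (P *m (A *m x)).
  by rewrite mulmxA defK dot_mulmx !mulmxA.
have eSv w : dot w (S *m v) = dot (B *m w) be by rewrite defv dot_mulmx.
have symS w z : dot w (S *m z) = dot z (S *m w).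
  by rewrite -{1}trS -dot_mulmx dotC.
have symP w z : dot w (P *m z) = dot z (P *m w).
  by rewrite -{1}trP -dot_mulmx dotC.
have symQ w z : dot w (Q *m z) = dot z (Q *m w).
  by rewrite -{1}trQ -dot_mulmx dotC.
have eP : qform P x = qform Q x + qform P (A *m x)
                      - dot (B *m (K *m x)) (P *m (A *m x)).
  rewrite [P in LHS]defP !qformE mulmxDl dotDr -!mulmxA -dot_mulmx.
  rewrite mulmxBl mulmxBr dotDr dotNr -mulmxA.
  by rewrite (symP (A *m x) (B *m _)) addrA.
have ebe : dot (Q *m th + Acl^T *m be) x
    = dot x (Q *m th) + dot be (A *m x) - dot be (B *m (K *m x)).
  rewrite dotDl (dotC (Q *m th)) dot_mulmx trmxK /Acl mulmxBl dotDr dotNr.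
  by rewrite -mulmxA addrA.
have eQx : qform Q (x - th) = qform Q x - 2 * dot x (Q *m th) + qform Q th.
  rewrite !qformE mulmxBr !(dotDr, dotDl, dotNr, dotNl) (symQ th x); ring.
have ePx : qform P (A *m x + B *m u) = qform P (A *m x)
   + 2 * dot (B *m u) (P *m (A *m x)) + qform P (B *m u).
  rewrite !qformE mulmxDr !(dotDr, dotDl) (symP (A *m x) (B *m u)); ring.
have eS : qform S (u + K *m x - v) = qform S u + qform S (K *m x) + qform S v
   + 2 * dot u (S *m (K *m x)) - 2 * dot u (S *m v) - 2 * dot (K *m x) (S *m v).
  rewrite !qformE !(mulmxDr, mulmxN) !(dotDr, dotDl, dotNr, dotNl).
  rewrite (symS (K *m x) u) (symS v u) (symS v (K *m x)); ring.
rewrite eQx ePx eS ebe eP eSu !eSK !eSv [qform S (K *m x)]qformE eSK dotDr.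
rewrite (dotC (B *m u) be) (dotC (B *m (K *m x)) be).
ring.
Qed.

Variables (N : nat) (theta : nat -> 'cV[R]_n).

(** The costate, that is, the linear coefficient of the cost-to-go: the backward recursion with zero
    terminal value, solved explicitly. *)
Definition adjoint t : 'cV[R]_n :=
  \sum_(t <= s < N) iter (s - t) (mulmx Acl^T) (Q *m theta s).

Lemma adjoint_rec t : (t < N)%N ->
  adjoint t = Q *m theta t + Acl^T *m adjoint t.+1.
Proof.
move=> tN; rewrite /adjoint big_ltn // subnn; congr (_ + _).
rewrite mulmx_sumr !big_nat; apply: eq_bigr => s /andP[ts _].
by rewrite -iterS -subSn.
Qed.

Definition feedforward t : 'cV[R]_m := invmx S *m (B^T *m adjoint t.+1).

Definition is_traj (x : nat -> 'cV[R]_n) (u : nat -> 'cV[R]_m) :=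
  x 0%N = 0 /\ forall t, x t.+1 = A *m x t + B *m u t.

Definition tracking_error x u t : 'cV[R]_m := u t + K *m x t - feedforward t.

Definition base_cost : R :=
  2^-1 * \sum_(t < N) (qform Q (theta t) - qform S (feedforward t)).

Hypothesis Su : S \in unitmx.

Lemma lqcost_square x u : is_traj x u ->
  lqcost N Q Rc P theta x u
  = base_cost + 2^-1 * \sum_(t < N) qform S (tracking_error x u t).
Proof.
case=> x0 xS; rewrite /lqcost /base_cost -!mulrDr; congr (_ * _).
(* Cost up to time [k] plus cost-to-go at [k]. At [k = 0] the state vanishes; at [k = N] the adjoint
   is an empty sum, so only the true terminal cost remains. *)
have tele k : (k <= N)%N ->
   \sum_(t < k) (qform Q (x t - theta t) + qform Rc (u t))
     + (qform P (x k) - 2 * dot (adjoint k) (x k))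
   = \sum_(t < k) (qform Q (theta t) - qform S (feedforward t))
     + \sum_(t < k) qform S (tracking_error x u t).
  elim: k => [|k IH] kN.
    by rewrite !big_ord0 x0 qformE mulmx0 !dot0r; ring.
  have ev : S *m feedforward k = B^T *m adjoint k.+1 by rewrite mulKVmx.
  have st := stage_cost_square (x k) (theta k) (u k) ev.
  rewrite -adjoint_rec // -xS in st.
  have IHk := IH (ltnW kN).
  rewrite !big_ord_recr /= /tracking_error.
  move: IHk st.
  move: (\sum_(t < k) _) (\sum_(t < k) _) (\sum_(t < k) _) => a b c.
  move=> IHk st; lra.
have := tele N (leqnn N).
by rewrite {1}/adjoint big_geq // dotC dot0r mulr0 subr0.
Qed.

Fixpoint opt_state t : 'cV[R]_n :=
  if t is t'.+1 then
    A *m opt_state t' + B *m (feedforward t' - K *m opt_state t')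
  else 0.

Definition opt_input t := feedforward t - K *m opt_state t.

Lemma traj_is_traj u : is_traj (traj A B u) u.
Proof. by []. Qed.

Lemma lqcost_opt :
  lqcost N Q Rc P theta (traj A B opt_input) opt_input = base_cost.
Proof.
rewrite (lqcost_square (traj_is_traj _)) big1 ?mulr0 ?addr0 // => t _.
have -> : tracking_error (traj A B opt_input) opt_input t = 0.
  have e s : traj A B opt_input s = opt_state s.
    by elim: s => //= s ->.
  by rewrite /tracking_error /opt_input e addrNK subrr.
by rewrite qformE mulmx0 dot0r.
Qed.

End CompletionOfSquares.

(** * Causality and averaging over signs *)

Section ClosedLoop.
Variable R : rcfType.
Variables (alg : online_alg R) (n m N : nat) (A : 'M[R]_n) (B : 'M[R]_(n, m)).

Lemma closed_loop_traj f g :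
  is_traj A B (cl_state alg N A B f g) (cl_input alg N A B f g).
Proof. by split=> // t; rewrite /cl_state /= ltnn. Qed.

Lemma cl_causal W f f' g t : lookahead W alg -> (0 < W)%N ->
  (forall s, (s < t + W)%N -> f s =1 f' s) ->
  cl_state alg N A B f g t = cl_state alg N A B f' g t /\
  cl_input alg N A B f g t = cl_input alg N A B f' g t.
Proof.
move=> causal W0 ff'.
(* The algorithm reads its whole history, so the induction compares complete histories and not just
   current states. *)
have hist : forall u, (u <= t)%N ->
    cl_hist alg N A B f g u =1 cl_hist alg N A B f' g u.
  elim=> [//|u IH] ut s /=; have {}IH := IH (ltnW ut); rewrite !IH.
  case: ifP => // _; congr (_ + _ *m _).
  apply: causal => // q qu v; apply: ff'.
  by rewrite (leq_trans qu) // leq_add2r ltnW.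
split; first exact: hist.
by apply: causal => [s _||//]; [exact: hist|exact: ff'].
Qed.

End ClosedLoop.

Section Signs.
Variable R : realFieldType.

Definition flip n (i : 'I_n) (e : {ffun 'I_n -> bool}) : {ffun 'I_n -> bool} :=
  [ffun j => (j == i) (+) e j].

Lemma flipK n (i : 'I_n) : involutive (flip i).
Proof. by move=> e; apply/ffunP => j; rewrite !ffunE addKb. Qed.

(** Pairing each pattern with its flip at [i] shows that the mean of [F i] over all patterns is at
    least [d / 2]; some pattern does at least as well as the mean of the sum. *)
Lemma exists_signs n (F : 'I_n -> {ffun 'I_n -> bool} -> R) (d : R) :
  (forall i e, d <= F i e + F i (flip i e)) ->
  exists e, n%:R * d / 2 <= \sum_i F i e.
Proof.
move=> dF; pose G e := \sum_i F i e - n%:R * d / 2.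
suff /existsP[e Ge] : [exists e, 0 <= G e] by exists e; rewrite -subr_ge0.
apply: contraT; rewrite negb_exists => /forallP Gneg.
suff: 0 <= \sum_e G e.
  rewrite (bigD1 [ffun=> false]) //= leNgt.
  have := Gneg [ffun=> false]; rewrite -ltNge => G0.
  rewrite -[ltRHS](addr0 0) ltr_leD // -oppr_ge0 -sumrN sumr_ge0 // => e _.
  by rewrite oppr_ge0 ltW // ltNge.
rewrite /G big_split /= exchange_big /=.
have half i : \sum_(e : {ffun 'I_n -> bool}) (d / 2) <= \sum_e F i e.
  suff: \sum_(e : {ffun 'I_n -> bool}) d <= \sum_e F i e + \sum_e F i e.
    by rewrite -mulr_suml; move: (\sum_e d) (\sum_e F i e) => x y; lra.
  rewrite [X in _ + X](reindex_inj (inv_inj (flipK i))) -big_split.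
  by apply: ler_sum => e _; apply: dF.
rewrite sumr_const mulNrn subr_ge0.
apply: le_trans (ler_sum _ (fun i _ => half i)).
rewrite sumr_const card_ord sumr_const -!mulrnA mulnC.
by rewrite -mulrA mulr_natl -mulrnA.
Qed.

End Signs.

(** * The hard system *)

Section System.
Variables (R : rcfType) (p : nat).
Hypothesis p_gt0 : (0 < p)%N.

Local Notation n := p.+2.

Definition blk (j : nat) : nat := if j is j'.+1 then (p + j')%N else 0%N.

Definition sysA : 'M[R]_n :=
  \matrix_(i, c) ((i < p)%N && ((c : nat) == (i.+1 %% p)%N))%:R.

Definition sysB : 'M[R]_(n, 3) := \matrix_(i, j) (i.+1 == blk j.+1)%N%:R.

Lemma sys_canonical : canonical_form sysA sysB blk.
Proof.
split=> //.
- by rewrite /blk addn2.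
- by case=> [|i] _ /=; lia.
- move=> i Hi c; have := Hi 1%N isT; have := Hi 2%N isT; have := Hi 3%N isT.
  rewrite /= mxE => h3 h2 h1; have := ltn_ord i => hi.
  have ip : (i.+1 < p)%N by lia.
  by rewrite modn_small // (ltnW ip).
- by move=> i j; rewrite mxE.
Qed.

Lemma sys_ctrb_index : ctrb_index 3 blk = p.
Proof. by rewrite /ctrb_index !big_ord_recl big_ord0 /= /bump /=; lia. Qed.

(** The row that input [j] enters: the chain ends in row [p - 1], and the two further blocks have
    length one. *)
Definition blk_last (j : 'I_3) : 'I_n := inord (p.-1 + j).

Lemma blk_lastE j : blk_last j = (p.-1 + j)%N :> nat.
Proof. by rewrite inordK //; have := ltn_ord j; lia. Qed.

Lemma trB_mulE q (M : 'M[R]_(n, q)) j c : (sysB^T *m M) j c = M (blk_last j) c.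
Proof.
rewrite mxE (bigD1 (blk_last j)) //= big1 => [|i].
  by rewrite !mxE blk_lastE /= -addSn prednK // eqxx mul1r addr0.
rewrite !mxE -val_eqE /= blk_lastE => ne.
by case: eqP => [e|]; [lia | rewrite mul0r].
Qed.

Lemma B_mulE q (M : 'M[R]_(3, q)) (i : 'I_n) c :
  (sysB *m M) i c = if (i.+1 < p)%N then 0 else M (inord (i.+1 - p)) c.
Proof.
have := ltn_ord i => hi; rewrite mxE; case: ifP => ip.
  by rewrite big1 // => j _; rewrite mxE /=; case: eqP => [e|]; [lia|rewrite mul0r].
rewrite (bigD1 (inord (i.+1 - p))) //= big1 => [|j].
  by rewrite mxE /= inordK ?subnKC ?eqxx ?mul1r ?addr0 //; lia.
rewrite mxE -val_eqE /= inordK => [ne|]; last by lia.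
by case: eqP => [e|]; [lia | rewrite mul0r].
Qed.

Lemma A_mulE q (M : 'M[R]_(n, q)) (i : 'I_n) c :
  (sysA *m M) i c = if (i < p)%N then M (inord (i.+1 %% p)) c else 0.
Proof.
rewrite mxE; case: ifP => ip; last first.
  by rewrite big1 // => j _; rewrite mxE ip mul0r.
have lp : (i.+1 %% p < p.+2)%N by rewrite (ltn_trans (ltn_pmod _ p_gt0)).

rewrite (bigD1 (inord (i.+1 %% p))) //= big1 => [|j].
  by rewrite mxE ip inordK // eqxx mul1r addr0.
by rewrite mxE ip -val_eqE /= inordK // => /negbTE ->; rewrite mul0r.
Qed.

(** Inverse of the cyclic successor on residues below [p]; it describes the transposed shift. *)
Definition cyc_pred (c : nat) : nat := if c is c'.+1 then c' else p.-1.

Lemma cyc_succ_eq i c : (i < p)%N -> (c < p)%N ->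
  (c == i.+1 %% p)%N = (i == cyc_pred c)%N.
Proof.
move=> ip cp; have [e|ne] := eqVneq i.+1 p.
  rewrite e modnn; case: c cp => [|c] cp /=; first by rewrite eqxx -e eqxx.
  by apply/esym/eqP => e2; lia.
rewrite modn_small; last by lia.
by case: c cp => [|c] cp /=; lia.
Qed.

Lemma cyc_pred_lt c : (c < p)%N -> (cyc_pred c < p)%N.
Proof. by case: c => [|c] /=; lia. Qed.

Variable r : R.
Hypotheses (r_gt0 : 0 < r) (r_lt1 : r < 1).

(* On the chain [R = r] and the diagonal of [Q] sums to [(1 - r)^2]; this makes
   [P_last = 1 - r], so [S = P_last + R = 1] and the closed-loop gain is [r]. *)
Definition qwt : R := (1 - r) ^+ 2 / p%:R.

(** Diagonal of [S]. Entries 1 and 2 are the two prescribed extreme eigenvalues; each is shared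
    equally between the state cost and the input cost of its channel. *)
Definition slack (j : nat) : R :=
  match j with 0 => 1 | 1 => (1 - r) ^+ 2 | _ => (1 + r) ^+ 2 end.

Definition sysQ : 'M[R]_n :=
  diag_mx (\row_i (if (i < p)%N then qwt else slack (i - p).+1 / 2)).

(** On the chain, every shift adds [qwt], and wrapping around multiplies the last entry [1 - r] by
    the loop gain [r]; this is the closed form of that recursion. *)
Definition sysP : 'M[R]_n :=
  diag_mx (\row_i (if (i < p)%N then (1 - r) * r + i.+1%:R * qwt
                   else slack (i - p).+1 / 2)).

Definition sysR : 'M[R]_3 :=
  diag_mx (\row_j (if ((j : nat) == 0)%N then r else slack j / 2)).

Definition sysS : 'M[R]_3 := diag_mx (\row_j slack j).

Definition sysK : 'M[R]_(3, n) :=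
  \matrix_(j, c) ((1 - r) * (((j : nat) == 0) && ((c : nat) == 0))%N%:R).

Lemma qwt_gt0 : 0 < qwt.
Proof. by rewrite divr_gt0 ?ltr0n // exprn_gt0 // subr_gt0. Qed.

Lemma slack_gt0 j : 0 < slack j.
Proof.
case: j => [|[|j]] /=; rewrite ?ltr01 // exprn_gt0 ?subr_gt0 //.
by rewrite addr_gt0.
Qed.

Lemma sysQ_diag_gt0 (i : 'I_n) :
  0 < (\row_(i < n) (if (i < p)%N then qwt else slack (i - p).+1 / 2)) 0 i.
Proof. by rewrite mxE; case: ifP; rewrite ?qwt_gt0 ?divr_gt0 ?slack_gt0. Qed.

Lemma sysQ_posdef : posdef sysQ.
Proof. exact/posdef_diag/sysQ_diag_gt0. Qed.

Lemma sysP_posdef : posdef sysP.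
Proof.
apply: posdef_diag => i; rewrite mxE; case: ifP => _.
  by rewrite addr_gt0 // mulr_gt0 ?ltr0n ?qwt_gt0 // subr_gt0.
by rewrite divr_gt0 ?slack_gt0.
Qed.

Lemma sysR_posdef : posdef sysR.
Proof.
by apply: posdef_diag => i; rewrite mxE; case: ifP; rewrite ?divr_gt0 ?slack_gt0.
Qed.

Lemma sysS_diag_gt0 (j : 'I_3) : 0 < (\row_(j < 3) slack j) 0 j.
Proof. by rewrite mxE slack_gt0. Qed.

Lemma sysS_unit : sysS \in unitmx.
Proof. exact/unitmx_diag/sysS_diag_gt0. Qed.

(** Feedback alters only the last row of the chain, where [1 - (1 - r) = r]. *)
Definition loop_gain (i : nat) : R := if i.+1 == p then r else 1.

Lemma sysAclE (i c : 'I_n) :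
  Acl sysA sysB sysK i c = loop_gain i * sysA i c.
Proof.
rewrite /Acl mxE [X in _ + X]mxE B_mulE !mxE /loop_gain.
have hi := ltn_ord i.
have [ip|ip] := ltnP i.+1 p.
  by rewrite (ltn_eqF ip) mul1r subr0.
rewrite inordK; last by lia.
have [e|ne] := eqVneq i.+1 p.
  have ip' : (i < p)%N by lia.
  by rewrite ip' e subnn modnn /=; case: (_ == _); ring.
rewrite (_ : (i < p)%N = false); last by lia.
rewrite (_ : (_ == 0%N) = false); last by lia.
by rewrite mulr0 subrr mulr0.
Qed.

Lemma trAcl_mulE q (M : 'M[R]_(n, q)) (c : 'I_n) d :
  ((Acl sysA sysB sysK)^T *m M) c d =
  if (c < p)%N then loop_gain (cyc_pred c) * M (inord (cyc_pred c)) d else 0.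
Proof.
rewrite mxE; case: ifP => cp; last first.
  rewrite big1 // => i _; rewrite mxE sysAclE mxE.
  case: andP => [[ip /eqP e]|]; last by rewrite mulr0 mul0r.
  by have := ltn_pmod i.+1 p_gt0; lia.
have pp := cyc_pred_lt cp.
have pn : (cyc_pred c < p.+2)%N by lia.
rewrite (bigD1 (inord (cyc_pred c))) //= big1 => [|i].
  by rewrite mxE sysAclE mxE inordK // pp cyc_succ_eq // eqxx mulr1 addr0.
rewrite mxE sysAclE mxE -val_eqE /= inordK // => ne.
case: andP => [[ip e]|]; last by rewrite mulr0 mul0r.
by rewrite cyc_succ_eq // (negbTE ne) in e.
Qed.

Lemma sysP_last : (1 - r) * r + p%:R * qwt = 1 - r.
Proof.
by rewrite /qwt mulrCA mulfV ?mulr1 ?pnatr_eq0 ?gtn_eqF //; ring.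
Qed.

Lemma sysS_def : sysS = sysB^T *m sysP *m sysB + sysR.
Proof.
rewrite -mulmxA; apply/matrixP => j j'.
rewrite [RHS]mxE trB_mulE mul_diag_mx /sysS /sysR !mxE blk_lastE.
rewrite -addSn prednK // eqn_add2l -(inj_eq val_inj) /=.
case: (_ == _); last by rewrite !mulr0n mulr0 addr0.
rewrite !mulr1n mulr1.
have pred1 : (p.-1 + 1)%N = p by lia.
have pred2 : (p.-1 + 2)%N = p.+1 by lia.
case: j => [[|[|[|j]]] hj] //=.
- by rewrite addn0 leqnn sysP_last; ring.
- by rewrite pred1 subnn addn1 ltnn; lra.
- rewrite pred2 subSnn (_ : (p + 2 <= p)%N = false); [lra|lia].
Qed.

Lemma sysK_def : sysS *m sysK = sysB^T *m sysP *m sysA.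
Proof.
apply/matrixP => j c; rewrite -mulmxA trB_mulE !mul_diag_mx !mxE blk_lastE.
case: j => [[|[|[|j]]] hj] //=; rewrite ?addn0 ?addn1 ?addn2.
- rewrite ltn_predL p_gt0 prednK // modnn sysP_last.
  by rewrite /= mul1r.
- by rewrite !prednK // ltnn /= !mulr0.
- by rewrite !prednK // (_ : (p.+1 < p)%N = false) ?mulr0 //; lia.
Qed.

Lemma sysP_def :
  sysP = sysQ + sysA^T *m sysP *m Acl sysA sysB sysK.
Proof.
(* Transposing puts [Acl^T] on the left, where [trAcl_mulE] applies. *)
rewrite -[RHS]trmxK; apply/esym; rewrite -[RHS]trmxK; congr (_^T).
rewrite linearD /= !trmx_mul trmxK !tr_diag_mx.
apply/matrixP => c d; rewrite mxE trAcl_mulE /sysP /sysQ !mul_diag_mx !mxE.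
case: ifP => cp; last by rewrite addr0.
have pp := cyc_pred_lt cp.
rewrite inordK ?pp; last by lia.
case: (ltnP d p) => dp; last first.
  rewrite (_ : (c == d) = false) ?mulr0n; last first.
    by apply/eqP => e; rewrite e ltnNge dp in cp.
  case: eqP => [e|]; last by rewrite !mulr0 addr0.
  by have := ltn_pmod (cyc_pred c).+1 p_gt0; lia.
rewrite /= cyc_succ_eq //.
have -> : (cyc_pred c == cyc_pred d) = (c == d).
  rewrite -val_eqE /=; case: (val c) (val d) cp dp => [|x] [|y] xp yp //=; lia.
case: (c == d); last by rewrite !mulr0 addr0.
rewrite !mulr1 !mulr1n /loop_gain.
case: (val c) cp => [|x] xp /=; first by rewrite prednK // eqxx sysP_last; ring.
by rewrite ltn_eqF // [x.+2%:R]mulrS; ring.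
Qed.

Lemma sys_dare : dare sysA sysB sysQ sysR sysP.
Proof.
by apply: dare_of_gain sysS_def sysK_def sysP_def sysS_unit.
Qed.

End System.

(** * Sensitivity of the feedforward to a single target *)

Section Sensitivity.
Variables (R : rcfType) (p : nat) (r : R).
Hypotheses (p_gt0 : (0 < p)%N) (r_gt0 : 0 < r) (r_lt1 : r < 1).
Local Notation n := p.+2.
Local Notation f := (mulmx (Acl (sysA R p) (sysB R p) (sysK p r))^T).

Lemma iter_trAcl_shift d (w : 'cV[R]_n) (c : 'I_n) : (d <= c)%N -> (c < p)%N ->
  iter d f w c 0 = w (inord (c - d)) 0.
Proof.
elim: d c => [|d IH] c dc cp /=; first by rewrite subn0 inord_val.
rewrite trAcl_mulE // cp /loop_gain.
case ec: (val c) dc cp => [|x] //= dx xp.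
rewrite ltn_eqF // mul1r IH ?inordK ?subSS //; lia.
Qed.

(** Each full turn of the cycle meets the gain [r] exactly once; the remaining [k %% p] steps,
    started from the last coordinate, shift without scaling. *)
Lemma iter_trAcl_last k (w : 'cV[R]_n) :
  iter k f w (inord p.-1) 0
  = r ^+ (k %/ p) * w (inord (p.-1 - k %% p)) 0.
Proof.
have lp : (inord p.-1 : 'I_n) = p.-1 :> nat by rewrite inordK //; lia.
have period (y : 'cV[R]_n) : iter p f y (inord p.-1) 0 = r * y (inord p.-1) 0.
  rewrite -[X in iter X _ _](prednK p_gt0) iterSr.
  rewrite iter_trAcl_shift ?lp ?leqnn ?ltn_predL // subnn.
  by rewrite trAcl_mulE // inordK //= p_gt0 /loop_gain prednK // eqxx.
have -> : iter k f w = iter (k %/ p * p + k %% p) f w by rewrite -divn_eq.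
elim: (k %/ p)%N => [|j IH].
  rewrite mul0n add0n expr0 mul1r iter_trAcl_shift ?lp //; last lia.
  by have := ltn_pmod k p_gt0; case: (p) p_gt0.
by rewrite mulSn -addnA iterD period IH exprS mulrA.
Qed.

(** The target at [t + W] enters [adjoint t.+1] after [W - 1] transposed closed-loop steps, whence
    the exponent [(W - 1) / p] and the coordinate given by the residue. *)
Lemma feedforward_flip N (theta theta' : nat -> 'cV[R]_n) t W :
  (0 < W)%N -> (t + W < N)%N ->
  (forall s, s != (t + W)%N -> theta s = theta' s) ->
  let ff := feedforward (sysA R p) (sysB R p) (sysQ p r) (sysS r) (sysK p r) N in
  let i := inord (p.-1 - (W.-1 %% p)) in
  ff theta t 0 0 - ff theta' t 0 0
  = r ^+ (W.-1 %/ p) * qwt p r * (theta (t + W)%N i 0 - theta' (t + W)%N i 0).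
Proof.
move=> W0 tW same ff i.
have ip : (i < p)%N by rewrite inordK; lia.
(* The first diagonal entry of [S] is 1, so its inverse disappears on the chain's input. *)
have ffE th : ff th t 0 0
    = adjoint (sysA R p) (sysB R p) (sysQ p r) (sysK p r) N th t.+1 (inord p.-1) 0.
  have := congr1 (fun M : 'cV[R]_3 => M 0 0)
    (mulKVmx (sysS_unit r_gt0 r_lt1) ((sysB R p)^T *m
      adjoint (sysA R p) (sysB R p) (sysQ p r) (sysK p r) N th t.+1)).
  rewrite mul_diag_mx [LHS]mxE [X in X * _]mxE mul1r trB_mulE // => ->.
  by rewrite /blk_last addn0.
rewrite !ffE /adjoint !summxE.
have split_at (F : nat -> R) : \sum_(t.+1 <= s < N) F s
    = \sum_(t.+1 <= s < t + W) F s + (F (t + W)%N + \sum_((t + W).+1 <= s < N) F s).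
  by rewrite -big_ltn // -big_cat_nat //=; lia.
rewrite !{}split_at.
have e a b : (forall s, (a <= s < b)%N -> s != (t + W)%N) ->
    \sum_(a <= s < b) iter (s - t.+1) f (sysQ p r *m theta s) (inord p.-1) 0
  = \sum_(a <= s < b) iter (s - t.+1) f (sysQ p r *m theta' s) (inord p.-1) 0.
  by move=> ab; rewrite !big_nat; apply: eq_bigr => s /ab/same ->.
rewrite e; last by move=> s; lia.
rewrite (e (t + W).+1); last by move=> s; lia.
rewrite (_ : (t + W - t.+1)%N = W.-1); last by lia.
rewrite !iter_trAcl_last -/i !mul_diag_mx !mxE ip; ring.
Qed.

End Sensitivity.

(** * The cost in the flat variables and its Hessian *)

Section FlatVariables.
Variables (R : rcfType) (p N : nat).
Hypothesis p_gt0 : (0 < p)%N.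
Local Notation n := p.+2.
Implicit Type Z : 'cV[R]_(N * 3).
Local Notation xZ Z := (@xz R n 3 (N * 3) (blk p) Z).
Local Notation uZ Z := (@uz R n 3 (N * 3) (sysA R p) (blk p) Z).

(** Truncated subtraction agrees with the convention for nonpositive times: they become 0, where
    [zval] vanishes. *)
Lemma xzE Z t (i : 'I_n) : xZ Z t i 0 =
  if (i < p)%N then zval 3%N Z (t + i.+1 - p) 0%N
  else zval 3%N Z t (i - p).+1.
Proof.
have hi := ltn_ord i.
rewrite mxE !big_ord_recl big_ord0 /= /bump /= !addn0 !add0n addr0.
case: ltnP => ip.
  rewrite (_ : (p < i.+1 <= _)%N = false); last lia.
  by rewrite (_ : (_ < i.+1 <= _)%N = false) ?addr0; last lia.
rewrite add0r.
have [e|ne] := eqVneq (i : nat) p.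
  rewrite (_ : (p < i.+1 <= _)%N); last lia.
  rewrite (_ : (_ < i.+1 <= _)%N = false) ?addr0; last lia.
  by rewrite e subnn addn1 addnK.
rewrite (_ : (p < i.+1 <= _)%N = false) ?add0r; last lia.
rewrite (_ : (_ < i.+1 <= _)%N); last lia.
by rewrite (_ : (i : nat) = p.+1) ?subSnn ?addn2 ?addnK //; lia.
Qed.

Lemma uzE Z t (j : 'I_3) :
  uZ Z t j 0 = zval 3%N Z t.+1 j - (sysA R p *m xZ Z t) (blk_last p j) 0.
Proof.
rewrite mxE; congr (_ - _); rewrite (big_pred1 (blk_last p j)).
  by rewrite mxE; apply: eq_bigr.
move=> i; rewrite /= -[RHS](inj_eq val_inj) /= blk_lastE //; lia.
Qed.

(** Makes [Cz] an instance of the completed-square formula: [uz] is built so that the input rows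
    hold, and the other rows are index shifts. *)
Lemma xz_traj Z : is_traj (sysA R p) (sysB R p) (xZ Z) (uZ Z).
Proof.
split=> [|t].
  apply/colP => i; rewrite xzE mxE; case: ifP => // ip.
  by rewrite (_ : (0 + i.+1 - p)%N = 0%N) //; lia.
apply/colP => i; have hi := ltn_ord i.
rewrite xzE [RHS]mxE B_mulE //; case: (ltnP i.+1 p) => ip.
  rewrite A_mulE // addr0 ltnW // xzE modn_small // inordK ?ip; last lia.
  by rewrite addSnnS.
rewrite uzE inordK; last lia.
have -> : blk_last p (inord (i.+1 - p)) = i.
  by apply: ord_inj; rewrite blk_lastE // inordK; lia.
rewrite addrC subrK; case: ifP => ip'; last by rewrite subSn //; lia.
have -> : i.+1 = p by lia.
by rewrite addnK subnn.
Qed.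

Lemma ZentryE Z k : Zentry Z k = \sum_(l < N * 3) (((l : nat) == k)%N%:R * Z l 0).
Proof.
rewrite /Zentry big_mkcond; apply: eq_bigr => l _.
by case: eqP; rewrite ?mul1r ?mul0r.
Qed.

Lemma dot_self Z : dot Z Z = \sum_(t < N)
  (zval 3%N Z t.+1 0%N ^+ 2 + zval 3%N Z t.+1 1%N ^+ 2 + zval 3%N Z t.+1 2%N ^+ 2).
Proof.
have entry (l : 'I_(N * 3)) : Zentry Z l = Z l 0.
  by rewrite /Zentry (big_pred1 l) // => i; rewrite val_eqE.
have -> : dot Z Z = \sum_(0 <= l < N * 3) Zentry Z l ^+ 2.
  rewrite big_mkord /dot mxE; apply: eq_bigr => l _.
  by rewrite entry mxE expr2.
rewrite big_nat_mul big_mkord; apply: eq_bigr => t _.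
rewrite mulSn -{1}[(t * 3)%N]add0n big_addn addnK big_mkord.
have zE k : Zentry Z (k + t * 3) = zval 3%N Z t.+1 k by rewrite addnC.
under eq_bigr do rewrite zE.
move: (zval 3%N Z t.+1) => g.
by rewrite !big_ord_recl big_ord0 [LHS]/= addr0 addrA.
Qed.

(** Delayed times truncated to 0 contribute [a 0 = 0], so the delayed sum is an initial segment of
    the other sum. *)
Lemma sum_shift_le (a : nat -> R) :
  a 0%N = 0 -> (forall s, 0 <= a s) ->
  \sum_(t < N) a (t.+1 - p)%N <= \sum_(t < N) a t.+1.
Proof.
move=> a0 a_ge0; elim: N => [|M IH]; first by rewrite !big_ord0.
have step K : \sum_(t < K) a (t.+1 - p)%N = \sum_(t < (K - p)%N) a t.+1.
  elim: K => [|K IHK]; first by rewrite sub0n !big_ord0.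
  rewrite big_ord_recr IHK /=; case: (leqP p K) => pK.
    by rewrite subSn // big_ord_recr.
  have -> : (K.+1 - p)%N = 0%N by lia.
  have -> : (K - p)%N = 0%N by lia.
  by rewrite !big_ord0 a0 addr0.
rewrite step -!(big_mkord xpredT (fun t => a t.+1)).
rewrite [leRHS](big_cat_nat (n := (M.+1 - p)%N)) ?leq_subr //=.
by rewrite lerDl sumr_ge0.
Qed.

Variable r : R.
Hypotheses (r_gt0 : 0 < r) (r_lt1 : r < 1).

(* The closed-loop innovation [u_t + K x_t] as a linear function of the stacked
   vector, so that the Hessian of the cost is [\sum_t M_t^T S M_t]. *)
Definition innov t : 'M[R]_(3, N * 3) :=
  \matrix_(j, l) (((l : nat) == t * 3 + j)%N%:R
    - r * (((j : nat) == 0) && (p <= t) && ((l : nat) == (t - p) * 3))%N%:R).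

Lemma innovE Z t (j : 'I_3) :
  (innov t *m Z) j 0 = zval 3%N Z t.+1 j
    - (if (j : nat) == 0%N then r * zval 3%N Z (t.+1 - p) 0%N else 0).
Proof.
rewrite mxE (eq_bigr (fun l : 'I_(N * 3) => ((l : nat) == t * 3 + j)%N%:R * Z l 0
    - r * ((((j : nat) == 0) && (p <= t) && ((l : nat) == (t - p) * 3))%N%:R * Z l 0))).
  rewrite sumrB -mulr_sumr /zval /= -ZentryE; congr (_ - _).
  case: ifP => // j0; last by rewrite /= big1 ?mulr0 // => l _; rewrite mul0r.
  congr (_ * _) => /=; case: ltnP => pt /=.
    rewrite (_ : (p <= t)%N) /=; last lia.
    by rewrite -ZentryE addn0 (_ : (t.+1 - p).-1 = (t - p)%N) //; lia.
  rewrite (_ : (p <= t)%N = false) /=; last lia.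
  by rewrite big1 // => l _; rewrite mul0r.
by move=> l _; rewrite mxE; ring.
Qed.

(** On the chain [u] contains [- z_(t+1-p)] from the cyclic row, and the feedback restores the
    fraction [1 - r] of it, leaving the factor [r]. *)
Lemma innov_feedback Z t : uZ Z t + sysK p r *m xZ Z t = innov t *m Z.
Proof.
have K_row (j : 'I_3) : (sysK p r *m xZ Z t) j 0
    = if (j : nat) == 0%N then (1 - r) * xZ Z t (inord 0) 0 else 0.
  rewrite mxE (bigD1 (inord 0)) //= big1 => [|i].
    by rewrite mxE inordK // andbT addr0; case: ifP; rewrite ?mulr1 ?mulr0 ?mul0r.
  rewrite mxE -val_eqE /= inordK // => /negbTE ->.
  by rewrite andbF mulr0 mul0r.
apply/colP => j; rewrite innovE mxE K_row uzE A_mulE // blk_lastE //.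
have hj := ltn_ord j.
have [j0|j0] := eqVneq (j : nat) 0%N.
  rewrite j0 addn0 ltn_predL p_gt0 prednK // modnn xzE inordK // p_gt0 addn1.
  ring.
by rewrite (_ : (_ < p)%N = false) ?addr0 //; lia.
Qed.

Definition hessian : 'M[R]_(N * 3) := \sum_(t < N) (innov t)^T *m sysS r *m innov t.

Lemma hessian_sym : hessian^T = hessian.
Proof.
rewrite /hessian linear_sum; apply: eq_bigr => t _ /=.
by rewrite !trmx_mul trmxK tr_diag_mx mulmxA.
Qed.

Lemma qform_hessian Z :
  qform hessian Z = \sum_(t < N) qform (sysS r) (innov t *m Z).
Proof.
rewrite qformE mulmx_suml dot_sumr; apply: eq_bigr => t _.
by rewrite -!mulmxA [in RHS]qformE dot_mulmx.
Qed.

Lemma qform_sysS (v : 'cV[R]_3) : qform (sysS r) v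
  = v 0 0 ^+ 2 + (1 - r) ^+ 2 * v 1 0 ^+ 2 + (1 + r) ^+ 2 * v (inord 2) 0 ^+ 2.
Proof.
rewrite qform_diag !big_ord_recl big_ord0 !mxE /= mul1r addr0 addrA.
congr (_ + _ * v _ 0 ^+ 2 + _ * v _ 0 ^+ 2); apply: ord_inj => //.
by rewrite inordK.
Qed.

(** Per-time form of the lower eigenvalue bound, with [b] standing for the delayed [a]; the two
    sides differ by [r] times a sum of squares. *)
Lemma shift_lower (a b y1 y2 : R) :
  (1 - r) * r * (a ^+ 2 - b ^+ 2)
  <= (a - r * b) ^+ 2 + (1 - r) ^+ 2 * y1 ^+ 2 + (1 + r) ^+ 2 * y2 ^+ 2
     - (1 - r) ^+ 2 * (a ^+ 2 + y1 ^+ 2 + y2 ^+ 2).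
Proof.
rewrite -subr_ge0 [leRHS](_ : _ = r * ((a - b) ^+ 2 + 4 * y2 ^+ 2)); last by ring.
by rewrite mulr_ge0 ?(ltW r_gt0) // addr_ge0 ?sqr_ge0 // mulr_ge0 ?sqr_ge0.
Qed.

Lemma shift_upper (a b y1 y2 : R) :
  (1 + r) * r * (a ^+ 2 - b ^+ 2)
  <= (1 + r) ^+ 2 * (a ^+ 2 + y1 ^+ 2 + y2 ^+ 2)
     - ((a - r * b) ^+ 2 + (1 - r) ^+ 2 * y1 ^+ 2 + (1 + r) ^+ 2 * y2 ^+ 2).
Proof.
rewrite -subr_ge0 [leRHS](_ : _ = r * ((a + b) ^+ 2 + 4 * y1 ^+ 2)); last by ring.
by rewrite mulr_ge0 ?(ltW r_gt0) // addr_ge0 ?sqr_ge0 // mulr_ge0 ?sqr_ge0.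
Qed.

(** The per-time bounds are summed over [t]; the differences [a^2 - b^2] add up to a nonnegative
    number by [sum_shift_le]. *)
Lemma hessian_bounds Z :
  (1 - r) ^+ 2 * dot Z Z <= qform hessian Z <= (1 + r) ^+ 2 * dot Z Z.
Proof.
pose z s := zval 3%N Z s 0%N.
have zN : \sum_(t < N) z (t.+1 - p)%N ^+ 2 <= \sum_(t < N) z t.+1 ^+ 2.
  apply: (@sum_shift_le (fun s => z s ^+ 2)) => [|s]; last exact: sqr_ge0.
  by rewrite /z /zval /= expr0n.
have v t : [/\ (innov t *m Z) 0 0 = z t.+1 - r * z (t.+1 - p)%N,
    (innov t *m Z) 1 0 = zval 3%N Z t.+1 1%N &
    (innov t *m Z) (inord 2) 0 = zval 3%N Z t.+1 2%N].
  by split; rewrite innovE ?inordK //= subr0.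
rewrite qform_hessian dot_self !mulr_sumr; apply/andP; split.
  have h : 0 <= (1 - r) * r *
      (\sum_(t < N) z t.+1 ^+ 2 - \sum_(t < N) z (t.+1 - p)%N ^+ 2).
    by rewrite !mulr_ge0 ?subr_ge0 // ltW.
  rewrite -subr_ge0 -sumrB; apply: le_trans h _.
  rewrite -sumrB mulr_sumr; apply: ler_sum => t _.
  have [e0 e1 e2] := v t; rewrite qform_sysS e0 e1 e2.
  exact: shift_lower.
have h : 0 <= (1 + r) * r *
    (\sum_(t < N) z t.+1 ^+ 2 - \sum_(t < N) z (t.+1 - p)%N ^+ 2).
  by rewrite !mulr_ge0 ?subr_ge0 ?addr_ge0 // ltW.
rewrite -subr_ge0 -sumrB; apply: le_trans h _.
rewrite -sumrB mulr_sumr; apply: ler_sum => t _.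
have [e0 e1 e2] := v t; rewrite qform_sysS e0 e1 e2.
exact: shift_upper.
Qed.

Lemma hessian_eigenvalue_bounds l :
  eigenvalue hessian l -> (1 - r) ^+ 2 <= l <= (1 + r) ^+ 2.
Proof.
case/eigenvalueP => v vH v0.
have Zv : dot v^T v^T > 0.
  have [_ /(_ v^T)] :=
    @posdef_diag R (N * 3) (const_mx 1) (fun i => ltac:(by rewrite mxE)).
  rewrite trmx_eq0 v0 qformE (_ : diag_mx _ = 1%:M) ?mul1mx; first by apply.
  by apply/matrixP => i j; rewrite !mxE.
have qv : qform hessian v^T = l * dot v^T v^T.
  by rewrite /qform /dot trmxK vH -scalemxAl mxE.
by have := hessian_bounds v^T; rewrite qv !ler_pM2r.
Qed.

(** The extra channels have no coupling in time: the coordinate of [z_1] in channel [j] is seen by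
    [innov 0] alone, so its basis vector is an eigenvector. *)
Lemma hessian_eigenvalue (j : 'I_3) : (0 < N)%N -> j != 0 ->
  eigenvalue hessian (slack r j).
Proof.
move=> N0 j0; have hj := ltn_ord j.
have lt : (j < N * 3)%N by lia.
pose l0 : 'I_(N * 3) := Ordinal lt.
have jn0 : ((j : nat) == 0)%N = false by apply/negbTE.
have innov_l0 t : innov t *m delta_mx l0 0
    = if t == 0%N then delta_mx j 0 else 0 :> 'cV[R]_3.
  apply/colP => i; rewrite -colE !mxE /=.
  rewrite (_ : (_ && (p <= t) && _)%N = false) ?mulr0 ?subr0; last by lia.
  have hi := ltn_ord i.
  have [->|t0] := eqVneq t 0%N; rewrite !mxE ?andbT -?val_eqE /=.
    by rewrite mul0n add0n eq_sym.
  by rewrite (_ : (_ == _) = false) //; lia.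
have innov_j : (innov 0)^T *m delta_mx j 0 = delta_mx l0 0 :> 'cV[R]_(N * 3).
  apply/colP => l; rewrite -colE !mxE jn0 /= mulr0 subr0 andbT.
  by rewrite -val_eqE /= mul0n add0n.
have S_j : sysS r *m delta_mx j 0 = slack r j *: delta_mx j 0 :> 'cV[R]_3.
  apply/colP => i; rewrite mul_diag_mx !mxE andbT.
  by case: eqVneq => [->|_] //; rewrite !mulr0.
apply/eigenvalueP; exists (delta_mx 0 l0); last first.
  by apply/eqP => /matrixP/(_ 0 l0); rewrite !mxE !eqxx => /eqP; rewrite oner_eq0.
apply: trmx_inj; rewrite trmx_mul hessian_sym linearZ /= trmx_delta.
rewrite /hessian mulmx_suml (bigD1 (Ordinal N0)) //= big1 ?addr0 => [|t t0].
  by rewrite -!mulmxA innov_l0 eqxx S_j -scalemxAr innov_j.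
by rewrite -!mulmxA innov_l0 ifN ?mulmx0 //; move: t0; rewrite -val_eqE.
Qed.

End FlatVariables.

(** * Targets and regret *)

Lemma vnorm_delta (R : rcfType) m (i : 'I_m) (a : R) :
  vnorm (a *: delta_mx i 0 : 'cV[R]_m) = `|a|.
Proof.
rewrite /vnorm -/(dot _ _) /dot mxE (bigD1 i) //= big1 => [|j /negbTE ji].
  by rewrite !mxE !eqxx mulr1 addr0 -expr2 sqrtr_sqr.
by rewrite !mxE ji mulr0 mul0r.
Qed.

Lemma pathlen_delta (R : rcfType) m (i : 'I_m) (a : nat -> R) N :
  pathlen N (fun s => a s *: delta_mx i 0 : 'cV[R]_m)
  <= 2 * \sum_(s < N.+1) `|a s|.
Proof.
rewrite /pathlen vnorm_delta.
(* Adding the final jump back to zero closes the induction: each amplitude is then charged once on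
   arrival and once on departure. *)
suff: `|a 0%N| + \sum_(1 <= t < N.+1)
        vnorm (a t *: delta_mx i 0 - a t.-1 *: delta_mx i 0 : 'cV[R]_m)
      + `|a N| <= 2 * \sum_(s < N.+1) `|a s|.
  by apply: le_trans; rewrite lerDl.
elim: N => [|N IH]; first by rewrite big_geq // big_ord1 addr0 mulrDl mul1r.
rewrite big_nat_recr //= big_ord_recr /= -scalerBl vnorm_delta.
have := ler_normB (a N.+1) (a N); move: IH.
move: (\sum_(1 <= t < N.+1) _) (\sum_(s < N.+1) _) => x y; lra.
Qed.

Section Targets.
Variables (R : rcfType) (p : nat) (thbar : R) (W M : nat).

(** [insub] makes the sign total in time; outside the window the result is masked by [amplitude]. *)
Definition sign_at (e : {ffun 'I_M -> bool}) (s : nat) : bool :=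
  oapp e false (insub (s - W)%N).

(** The window starts at [W] so that the target at [i + W] is paired with the decision at time
    [i < M]. *)
Definition amplitude e s : R :=
  if (W <= s < W + M)%N then (-1) ^+ (sign_at e s) * thbar else 0.

Definition target_dir : 'I_p.+2 := inord (p.-1 - W.-1 %% p).

Definition target e s : 'cV[R]_p.+2 := amplitude e s *: delta_mx target_dir 0.

Lemma sign_at_flip e (i : 'I_M) s : (W <= s)%N ->
  sign_at (flip i e) s = (s == i + W)%N (+) sign_at e s.
Proof.
move=> Ws; rewrite /sign_at; case: insubP => [j jM ej|] /=.
  by rewrite ffunE -val_eqE /= ej; congr (_ (+) _); lia.
by have := ltn_ord i => iM sM; rewrite addbF; apply/esym/eqP; lia.
Qed.

Lemma target_flip_eq e (i : 'I_M) s :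
  s != (i + W)%N -> target (flip i e) s = target e s.
Proof.
move=> si; rewrite /target /amplitude; case: andP => // -[Ws _].
by rewrite sign_at_flip // (negbTE si).
Qed.

Lemma amplitude_flip e (i : 'I_M) :
  amplitude (flip i e) (i + W)%N = - amplitude e (i + W)%N.
Proof.
rewrite /amplitude (_ : (W <= i + W < W + M)%N); last by have := ltn_ord i; lia.
by rewrite sign_at_flip ?leq_addl // eqxx /= signrN mulNr.
Qed.

Lemma target_eq0 e s : (W + M <= s)%N -> target e s = 0.
Proof. by move=> Ms; rewrite /target /amplitude (ltnNge s) Ms andbF scale0r. Qed.

Hypothesis thbar_gt0 : 0 < thbar.

Lemma norm_amplitude e s :
  `|amplitude e s| = if (W <= s < W + M)%N then thbar else 0.
Proof.
rewrite /amplitude; case: ifP; rewrite ?normr0 // normrM normrX normrN1 expr1n.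
by rewrite mul1r gtr0_norm.
Qed.

Lemma vnorm_target e s : vnorm (target e s) <= thbar.
Proof. by rewrite vnorm_delta norm_amplitude; case: ifP => // _; rewrite ltW. Qed.

Lemma pathlen_target e N : pathlen N (target e) <= 2 * M%:R * thbar.
Proof.
apply: le_trans (pathlen_delta _ _ _) _; rewrite -mulrA ler_pM2l //.
suff: \sum_(s < N.+1) `|amplitude e s| = (minn N.+1 (W + M) - W)%N%:R * thbar.
  by move=> ->; rewrite ler_pM2r // ler_nat; lia.
elim: N.+1 => [|k IH]; first by rewrite big_ord0 min0n sub0n mul0r.
rewrite big_ord_recr /= IH norm_amplitude; case: ifP => Wk.
  rewrite (_ : minn k.+1 _ - W = (minn k (W + M) - W).+1)%N; last by lia.
  by rewrite mulrS mulrDl mul1r addrC.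
by rewrite addr0 (_ : minn k.+1 _ - W = minn k (W + M) - W)%N //; lia.
Qed.

End Targets.

(** * Condition number and regret of the hard system *)

Section Regret.
Variables (R : rcfType) (p : nat) (r : R).
Hypotheses (p_gt0 : (0 < p)%N) (r_gt0 : 0 < r) (r_lt1 : r < 1).
Local Notation n := p.+2.
Local Notation A := (sysA R p).
Local Notation B := (sysB R p).
Local Notation Q := (sysQ p r).
Local Notation P := (sysP p r).
Local Notation Rc := (sysR r).
Local Notation S := (sysS r).
Local Notation K := (sysK p r).

Lemma sys_lqcost N theta x u : is_traj A B x u ->
  lqcost N Q Rc P theta x u
  = base_cost A B Q S K N theta
    + 2^-1 * \sum_(t < N) qform S (tracking_error A B Q S K N theta x u t).
Proof.
apply: lqcost_square; do 3?exact: tr_diag_mx.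
- exact: sysS_def.
- exact: sysK_def.
- exact: sysP_def.
- exact: sysS_unit.
Qed.

Lemma sys_quad_cond N theta : (0 < N)%N ->
  quad_cond (@Cz R n 3 N A (blk p) Q Rc P theta) ((1 + r) ^+ 2 / (1 - r) ^+ 2).
Proof.
move=> N0; pose v := feedforward A B Q S K N theta.
have symS x y : dot x (S *m y) = dot y (S *m x).
  by rewrite -[S in LHS]trmxK tr_diag_mx -dot_mulmx dotC.
(* Expansion of the squares of [innov t *m Z - v t]: the targets enter only the linear and constant
   terms. *)
exists (hessian p N r), (- \sum_(t < N) ((innov p N r t)^T *m (S *m v t))),
  (base_cost A B Q S K N theta + 2^-1 * \sum_(t < N) qform S (v t)).
split; first exact: hessian_sym.
- move=> Z; rewrite /Cz sys_lqcost; last exact: xz_traj.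
  rewrite -[((hessian p N r)%R : _)]/(hessian p N r).
  rewrite -/(qform (hessian p N r) Z) -/(dot _ Z) qform_hessian dotNl dotC dot_sumr.
  have -> : \sum_(t < N) qform S (tracking_error A B Q S K N theta
        (@xz R n 3 (N * 3) (blk p) Z) (@uz R n 3 (N * 3) A (blk p) Z) t)
    = \sum_(t < N) qform S (innov p N r t *m Z)
      - 2 * \sum_(t < N) dot Z ((innov p N r t)^T *m (S *m v t))
      + \sum_(t < N) qform S (v t).
    rewrite mulr_sumr -sumrB -big_split; apply: eq_bigr => t _ /=.
    rewrite /tracking_error innov_feedback // -/(v t) -dot_mulmx !qformE.
    rewrite mulmxBr !(dotDr, dotDl, dotNr, dotNl) (symS (v t)); ring.
  by field.
exists (slack r 1), (slack r 2); split=> /=.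
- by have := @hessian_eigenvalue R p N p_gt0 r r_gt0 r_lt1 (@Ordinal 3 1 isT); apply.
- by have := @hessian_eigenvalue R p N p_gt0 r r_gt0 r_lt1 (@Ordinal 3 2 isT); apply.
- exact: hessian_eigenvalue_bounds.
- by rewrite exprn_gt0 // subr_gt0.
- by [].
Qed.

Lemma sys_regret (thbar : R) (W M N : nat) (alg : online_alg R) :
  0 < thbar -> (0 < W)%N -> lookahead W alg -> (W + M <= N)%N ->
  exists e : {ffun 'I_M -> bool},
    2^-1 * (M%:R * (r ^+ (W.-1 %/ p) * qwt p r * thbar) ^+ 2)
    <= alg_cost alg N A B Q Rc P (target p thbar W e)
       - base_cost A B Q S K N (target p thbar W e).
Proof.
move=> thbar_gt0 W_gt0 causal WMN; set d := _ * thbar.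
pose x (e : {ffun 'I_M -> bool}) :=
  cl_state alg N A B (fcost Q (target p thbar W e)) (gcost Rc).
pose u (e : {ffun 'I_M -> bool}) :=
  cl_input alg N A B (fcost Q (target p thbar W e)) (gcost Rc).
pose err (e : {ffun 'I_M -> bool}) t :=
  tracking_error A B Q S K N (target p thbar W e) (x e) (u e) t.
(* A flip moves the first feedforward entry by [2 d] in absolute value while the decision stays
   fixed, and two squares whose centres are [2 d] apart sum to at least [2 d^2]. *)
have [i e|e he] := @exists_signs R M (fun i e => err e i 0 0 ^+ 2) (2 * d ^+ 2).
  have iW : (i + W < N)%N by have := ltn_ord i; lia.
  (* The only altered target, at [i + W], is just beyond the lookahead at time [i]. *)
  have [ex eu] : x (flip i e) i = x e i /\ u (flip i e) i = u e i.
    apply: cl_causal causal W_gt0 _ => s siW v.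
    by rewrite /fcost target_flip_eq // neq_ltn siW.
  have := feedforward_flip p_gt0 r_gt0 r_lt1 W_gt0 iW
    (@target_flip_eq R p thbar W M e i).
  rewrite -/target_dir /err /tracking_error ex eu.
  have entry s (e' : {ffun 'I_M -> bool}) :
      target p thbar W e' s (target_dir p W) 0 = amplitude thbar W e' s.
    by rewrite !mxE !eqxx mulr1.
  rewrite !entry amplitude_flip.
  have amp2 : amplitude thbar W e (i + W)%N ^+ 2 = thbar ^+ 2.
    rewrite /amplitude (_ : (W <= i + W < W + M)%N); last by have := ltn_ord i; lia.
    by rewrite exprMn sqrr_sign mul1r.
  move: (feedforward A B Q S K N (target p thbar W (flip i e)) i) => v'.
  move: (feedforward A B Q S K N (target p thbar W e) i) => v.
  have coord w : (u e i + K *m x e i - w) 0 0 = (u e i + K *m x e i) 0 0 - w 0 0.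
    by rewrite !mxE.
  rewrite !{}coord; move: ((u e i + _) 0 0) (v 0 0) (v' 0 0) => y {}v {}v' vv'.
  have -> : d ^+ 2 = (v' - v) ^+ 2 / 4.
    by rewrite vv' /d; move: (_ * qwt p r) => g; rewrite exprMn -amp2; field.
  rewrite -subr_ge0 [leRHS](_ : _ = 2 * (y - (v + v') / 2) ^+ 2); last by field.
  by rewrite mulr_ge0 ?sqr_ge0.
exists e; rewrite /alg_cost sys_lqcost; last exact: closed_loop_traj.
rewrite addrC addKr ler_pM2l ?invr_gt0 //.
apply: le_trans (_ : \sum_(i < M) err e i 0 0 ^+ 2 <= _).
  by apply: le_trans he; rewrite -mulrA mulrAC mulfV ?mul1r // pnatr_eq0.
have MN : (M <= N)%N by lia.
rewrite -!(big_mkord xpredT (fun t => err e t 0 0 ^+ 2)).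
rewrite -(big_mkord xpredT (fun t => qform S (err e t))).
(* Times from [M] on, and then the two extra channels, are dropped as nonnegative. *)
rewrite [leRHS](big_cat_nat (n := M)) //= -[leLHS]addr0 lerD //; last first.
  by rewrite sumr_ge0 // => t _; apply/qform_diag_ge0/sysS_diag_gt0.
apply: ler_sum => t _; rewrite qform_sysS -addrA lerDl.
by rewrite addr_ge0 // mulr_ge0 ?sqr_ge0.
Qed.

End Regret.

(** * Number of targets and assembly of the bound *)

(** [M] is taken maximal. If the path budget stops it, [L <= 2 (M + 1) b <= 4 M b]; if the horizon
    stops it, [M >= 2 N / 3], and [L <= (2 N + 1) b <= (3 M + 1) b]. *)
Lemma exists_block_length (R : realFieldType) (b L : R) (N W : nat) :
  0 < b -> (0 < W)%N -> (3 * W <= N)%N -> 4 * b <= L -> L <= (2 * N%:R + 1) * b ->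
  exists M : nat, [/\ 2 * M%:R * b <= L, (W + M <= N)%N & L <= 4 * M%:R * b].
Proof.
move=> b0 W0 WN bL Lb; pose ok M := (2 * M%:R * b <= L) && (W + M <= N)%N.
have WN1 : (W + 1 <= N)%N by clear -W0 WN; lia.
have ok1 : ok 1%N by rewrite /ok WN1 andbT mulr1 (le_trans _ bL) // ler_pM2r // ler_nat.
have ok_ex : exists M, ok M by exists 1%N.
have ok_le M : ok M -> (M <= N)%N by case/andP=> _; apply/leq_trans/leq_addl.
case: (ex_maxnP ok_ex ok_le) => M /andP[ML MN] Mmax.
exists M; split=> //; have M1 : 1 <= M%:R :> R by rewrite ler1n; apply: Mmax.
have [WM|WM] := leqP (W + M.+1) N.
  have : ~~ ok M.+1 by apply/negP => /Mmax; rewrite ltnn.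
  rewrite /ok WM andbT -ltNge -[M.+1%:R]natr1 => /ltW /le_trans; apply.
  by rewrite ler_pM2r //; clear -M1; lra.
have NM : (2 * N <= 3 * M)%N by clear -W0 WN WM; lia.
apply: le_trans Lb _; rewrite ler_pM2r //.
have : (2 * N%:R : R) <= 3 * M%:R by rewrite -!natrM ler_nat.
by clear -M1; lra.
Qed.

Theorem theorem3 (R : rcfType) (zeta : R) (p : nat) (thbar : R) :
  1 < zeta -> (1 <= p)%N -> 0 < thbar ->
  exists c : R, 0 < c /\
  forall (N W : nat) (LN : R),
    (1 <= W)%N -> (3 * W <= N)%N ->
    4 * thbar <= LN -> LN <= (2 * N%:R + 1) * thbar ->
    forall alg : online_alg R, lookahead W alg ->
    exists (n m : nat) (A : 'M[R]_n) (B : 'M[R]_(n, m)) (Q Pe : 'M[R]_n)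
           (Rc : 'M[R]_m) (theta : nat -> 'cV[R]_n) (k : nat -> nat),
      (posdef Q /\ posdef Rc /\ posdef Pe /\ dare A B Q Rc Pe) /\
      ((forall t, vnorm (theta t) <= thbar) /\
       (forall t, (N <= t)%N -> theta t = 0)) /\
      (canonical_form A B k /\ ctrb_index m k = p) /\
      pathlen N theta <= LN /\
      quad_cond (@Cz R n m N A k Q Rc Pe theta) zeta /\
      exists uopt : nat -> 'cV[R]_m,
        (forall u : nat -> 'cV[R]_m,
            lqcost N Q Rc Pe theta (traj A B uopt) uopt
              <= lqcost N Q Rc Pe theta (traj A B u) u) /\
        let K := ((W - 1) %/ p)%N in
        let rho := (Num.sqrt zeta - 1) / (Num.sqrt zeta + 1) in
        let Jstar := lqcost N Q Rc Pe theta (traj A B uopt) uopt in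
        let regret := alg_cost alg N A B Q Rc Pe theta - Jstar in
        c * rho ^+ (2 * K) * LN <= regret /\
        c * rho ^+ (2 * K) * pathlen N theta <= regret.
Proof.
move=> zeta1 p1 th0; set rho := _ / _.
pose s := Num.sqrt zeta.
have s2 : s ^+ 2 = zeta by rewrite sqr_sqrtr // ltW // (lt_trans ltr01).
have s1 : 1 < s by rewrite -sqrtr1 ltr_sqrt // (lt_trans ltr01).
have r0 : 0 < rho by rewrite divr_gt0; rewrite -/s; lra.
have r1 : rho < 1 by rewrite /rho -/s ltr_pdivrMr; lra.
(* [rho] inverts the map sending [r] to [((1 + r) / (1 - r))^2]. *)
have zetaE : (1 + rho) ^+ 2 / (1 - rho) ^+ 2 = zeta.
  rewrite -s2 /rho -/s -expr_div_n; congr (_ ^+ 2); field.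
  by apply/andP; split; lra.
have q0 := qwt_gt0 p1 r1.
(* Solves [c * (4 M thbar) = M (qwt * thbar)^2 / 2], matching [L <= 4 M thbar] with the regret
   bound; only [thbar], [p] and [zeta] occur in it. *)
pose c := thbar * qwt p rho ^+ 2 / 8.
have c0 : 0 < c by rewrite divr_gt0 // mulr_gt0 // exprn_gt0.
exists c; split=> //.
move=> N W LN W1 WN LN4 LNN alg causal.
have [M [ML MN LM]] := exists_block_length th0 W1 WN LN4 LNN.
have N0 : (0 < N)%N by rewrite (leq_trans _ WN) // muln_gt0.
have [e he] := sys_regret p1 r0 r1 th0 W1 causal MN.
pose th := target p thbar W e.
pose uopt := opt_input (sysA R p) (sysB R p) (sysQ p rho) (sysS rho) (sysK p rho) N th.
have Jopt : lqcost N (sysQ p rho) (sysR rho) (sysP p rho) th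
    (traj (sysA R p) (sysB R p) uopt) uopt
    = base_cost (sysA R p) (sysB R p) (sysQ p rho) (sysS rho) (sysK p rho) N th.
  by apply: lqcost_opt;
    [exact: tr_diag_mx | exact: tr_diag_mx | exact: tr_diag_mx | exact: sysS_def
    | exact: sysK_def | exact: sysP_def | exact: sysS_unit].
have regret : c * rho ^+ (2 * ((W - 1) %/ p)) * LN
    <= alg_cost alg N (sysA R p) (sysB R p) (sysQ p rho) (sysR rho) (sysP p rho) th
       - base_cost (sysA R p) (sysB R p) (sysQ p rho) (sysS rho) (sysK p rho) N th.
  apply: le_trans he; rewrite subn1 mulnC exprM.
  set g := rho ^+ _; have g0 : 0 <= g by rewrite exprn_ge0 // ltW.
  rewrite [leRHS](_ : _ = c * g ^+ 2 * (4 * M%:R * thbar));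
    last by rewrite /c; move: (qwt p rho) => q; field.
  by rewrite ler_wpM2l // mulr_ge0 ?(ltW c0) ?sqr_ge0.
exists p.+2, 3%N, (sysA R p), (sysB R p), (sysQ p rho), (sysP p rho),
  (sysR rho), th, (blk p).
have path_le : pathlen N th <= LN by apply: le_trans (pathlen_target _ _ _ _ _) ML.
split; first by split; [exact: sysQ_posdef | split; [exact: sysR_posdef |
  split; [exact: sysP_posdef | exact: sys_dare]]].
split.
  split=> t; first exact: vnorm_target.
  by move=> Nt; apply: target_eq0; apply: leq_trans MN Nt.
split; first by split; [exact: sys_canonical | exact: sys_ctrb_index].
split; first exact: path_le.
split; first by rewrite -zetaE; apply: sys_quad_cond.
exists uopt; split.
  move=> u; rewrite Jopt sys_lqcost // lerDl mulr_ge0 ?invr_ge0 // sumr_ge0 // => t _.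
  exact/qform_diag_ge0/sysS_diag_gt0.
rewrite /= Jopt; split; first exact: regret.
apply: le_trans regret; rewrite ler_wpM2l //.
by rewrite mulr_ge0 ?exprn_ge0 // ltW.
Qed.
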